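(* Let $n\ge 2$ and $k\ge 2$ be integers, let $a_1,a_2,\dots,a_k$ be distinct elements of $\mathbb{F}_{2^{n-1}}\setminus\{0\}$ and let $b_1,b_2$ be distinct elements of $\mathbb{F}_{2^n}\setminus\mathbb{F}_{2^{n-1}}$. Then $$r(\{a_1,\dots,a_k,b_1,b_2\})=r(\{a_1,\dots,a_k\})+\begin{cases}6 & \text{if } b_1+b_2\in\{a_1,\dots,a_k\},\\ 0 & \text{otherwise.}\end{cases}$$
   Context: For a subset $X$ of a finite additive abelian group, the $r$-value $r(X)$ is the number of ordered pairs $(x,y)\in X\times X$ with $x+y\in X$. Only the additive group of $\mathbb{F}_{2^n}$ is used: its elements are written as vectors $[\alpha_1,\dots,\alpha_n]$ with $\alpha_i\in\{0,1\}$ and addition coordinatewise modulo 2. By convention $\mathbb{F}_{2^{n-1}}$ is regarded as the subset of $\mathbb{F}_{2^n}$ consisting of the vectors with first coordinate $\alpha_1=0$. *)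

(* Defs.v *)
From mathcomp Require Import all_boot all_order all_algebra.

Set Implicit Arguments.
Unset Strict Implicit.
Unset Printing Implicit Defensive.

Import GRing.Theory.
Local Open Scope ring_scope.

Definition rvalue (G : finZmodType) (X : {set G}) : nat :=
  #|[set p : G * G | [&& p.1 \in X, p.2 \in X & p.1 + p.2 \in X]]|.

(* The additive group of the field with 2 ^ n elements, in coordinates. *)
Notation F2vec n := 'rV['F_2]_n.

(* The copy of F2vec n.-1 inside F2vec n: the vectors whose first coordinate is
   0. Coordinates are numbered from 0, and the condition on the index avoids
   having to write n as a successor. *)
Definition subF2 (n : nat) : {set F2vec n} :=
  [set v : F2vec n | [forall i : 'I_n, (i == 0%N :> nat) ==> (v 0 i == 0)]].

(* Main.v *)
Require Import Defs.
From mathcomp Require Import all_boot all_order all_algebra.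

Set Implicit Arguments.
Unset Strict Implicit.
Unset Printing Implicit Defensive.

Import GRing.Theory.
Local Open Scope ring_scope.

(** In a sum x + y = z inside A :|: [set b1; b2], with A inside the subgroup
H of index 2 and b1, b2 outside it, parity modulo H forces either none or
exactly two of x, y, z to lie outside H. The first kind of sum is
counted by [rvalue A]. In the second kind, the two terms outside H cannot be
equal, since otherwise the third would be 0, which is not in A; so they are b1
and b2, and the third is b1 + b2, because every element is its own opposite.
Hence such sums exist only when b1 + b2 is in A, and they are then the ordered
pairs of distinct nonzero elements of the Klein four-group
{0, b1, b2, b1 + b2}: there are 3 * 2 = 6 of them ([klein_pairs],
[card_klein_pairs], [sum_closed_add_pair]). *)

Section ElementaryTwoGroup.

Variable G : finZmodType.
Hypothesis addrr2 : forall x : G, x + x = 0.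

Definition klein_pairs (b1 b2 : G) : {set G * G} :=
  let T := [set b1; b2; b1 + b2] in
  [set p | [&& p.1 \in T, p.2 \in T & p.1 != p.2]].

Lemma addr2_eq (x y z : G) : (x + y == z) = (x == y + z).
Proof. by rewrite -[RHS](inj_eq (addrI y)) addrA addrr2 add0r addrC. Qed.

Lemma card_klein_pairs (b1 b2 : G) :
  b1 != 0 -> b2 != 0 -> b1 != b2 -> #|klein_pairs b1 b2| = 6.
Proof.
move=> b1_neq0 b2_neq0 b12.
set s := b1 + b2.
have b1s : b1 != s by rewrite eq_sym /s addrC addr2_eq addrr2.
have b2s : b2 != s by rewrite eq_sym /s addr2_eq addrr2.
have -> : klein_pairs b1 b2 =
    [set:: [:: (b1, b2); (b1, s); (b2, b1); (b2, s); (s, b1); (s, b2)]].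
  apply/setP => -[x y]; rewrite !inE /= !xpair_eqE -/s.
  have [->|_] := eqVneq x b1.
    rewrite (negPf b12) (negPf b1s) /= [b1 == y]eq_sym.
    by have [->|_] := eqVneq y b1; rewrite ?(negPf b12) ?(negPf b1s) ?andbT ?orbF.
  have [->|_] := eqVneq x b2.
    rewrite (negPf b2s) /= [b2 == y]eq_sym.
    have [->|_] := eqVneq y b2; last by rewrite ?andbT ?orbF.
    by rewrite eq_sym (negPf b12) (negPf b2s).
  have [->|_] //= := eqVneq x s; rewrite [s == y]eq_sym.
  have [->|_] := eqVneq y s; last by rewrite ?andbT ?orbF.
  by rewrite ![s == _]eq_sym (negPf b1s) (negPf b2s).
rewrite cardsE; apply/card_uniqP.
by rewrite /= !inE !xpair_eqE ![s == _]eq_sym [b2 == b1]eq_sym !eqxx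
   (negPf b12) (negPf b1s) (negPf b2s).
Qed.

(** The condition [addH] says that H is a subgroup of index at most 2. *)
Variables (H A : {set G}) (b1 b2 : G).
Hypothesis addH : forall x y, (x + y \in H) = ((x \in H) == (y \in H)).
Hypothesis sAH : A \subset H :\ 0.
Hypotheses (b1H : b1 \notin H) (b2H : b2 \notin H) (b12 : b1 != b2).

Let B := [set b1; b2].
Let s := b1 + b2.

Let A_H x : x \in A -> x \in H.
Proof. by move/(subsetP sAH); rewrite !inE => /andP[]. Qed.

Let A_neq0 x : x \in A -> x != 0.
Proof. by move/(subsetP sAH); rewrite !inE => /andP[]. Qed.

Let B_notin_H x : x \in B -> x \notin H.
Proof. by case/set2P=> ->. Qed.

(** Translation by a nonzero z can only keep an element of B inside B by
exchanging b1 and b2. *)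
Let addr_mem_pair (z y : G) : z != 0 -> y \in B -> (z + y \in B) = (z == s).
Proof.
move=> z0 /set2P[]->; rewrite !inE !addr2_eq addrr2 (negPf z0) //.
by rewrite orbF addrC.
Qed.

(** Either x, y and x + y all lie in H, and so in A, or exactly one of them does.
In the latter case that one must be b1 + b2: by [addr_mem_pair] when it is x or
y, and because the two others are b1 and b2 when it is x + y. *)
Lemma sum_closed_add_pair x y :
  [&& x \in A :|: B, y \in A :|: B & x + y \in A :|: B] =
  [&& x \in A, y \in A & x + y \in A]
  || (s \in A) && ((x, y) \in klein_pairs b1 b2).
Proof.
have sH : s \in H by rewrite addH (negPf b1H) (negPf b2H).
have notA u : u \notin H -> (u \in A) = false by apply/contraNF/A_H.
have notB u : u \in H -> (u \in B) = false.
  by move=> uH; apply: contraTF uH; apply: B_notin_H.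
have nots u : u \notin H -> (u == s) = false.
  by apply: contraNF => /eqP ->.
rewrite [_ \in klein_pairs _ _]inE /= -/s -/B.
rewrite ![_ \in B :|: _]inE ![_ \in A :|: B]inE ![_ \in [set s]]inE.
have := addH x y.
have [xH|xH] := boolP (x \in H); have [yH|yH] := boolP (y \in H) => /= xyH.
- rewrite !notB // !orbF /=.
  by have [->|] := eqVneq x s; have [->|] := eqVneq y s;
    rewrite ?eqxx ?andbF ?orbF.
- rewrite (notB x) // (notA y) // (notA (x + y)) ?xyH // (nots y) // !orbF.
  rewrite andbF /=.
  have -> : x != y by apply: contraNneq yH => <-.
  rewrite andbT; have [yB|] := boolP (y \in B); last by rewrite !andbF.
  have [xA|xA] /= := boolP (x \in A).
    by rewrite addr_mem_pair ?A_neq0 //; case: eqP xA => [-> ->|]; rewrite ?andbF.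
  by case: eqP xA => [-> /negPf->|]; rewrite ?andbF.
- rewrite (notA x) // (notB y) // (notA (x + y)) ?xyH // (nots x) // !orbF /=.
  have -> : x != y by apply: contraNneq xH => ->.
  rewrite andbT; have [xB|] := boolP (x \in B); last by rewrite !andbF.
  have [yA|yA] /= := boolP (y \in A).
    rewrite addrC addr_mem_pair ?A_neq0 //.
    by case: eqP yA => [-> ->|]; rewrite ?andbF.
  by case: eqP yA => [-> /negPf->|]; rewrite ?andbF.
- rewrite (notA x) // (notA y) // (notB (x + y)) ?xyH // !nots // !orbF /=.
  have [xB|] := boolP (x \in B); last by rewrite /= andbF.
  have [yB|] := boolP (y \in B); last by rewrite /= andbF.
  have [->|xy] /= := eqVneq x y.
    by rewrite addrr2 andbF; apply/negP => /A_neq0; rewrite eqxx.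
  suff -> : x + y = s by rewrite andbT.
  case/set2P: xB xy => ->; case/set2P: yB => ->; rewrite ?eqxx // => _.
  by rewrite addrC.
Qed.

Theorem rvalue_add_pair :
  rvalue (A :|: [set b1; b2]) =
  (rvalue A + (if (b1 + b2)%R \in A then 6 else 0))%N.
Proof.
pose R := [set p : G * G | [&& p.1 \in A, p.2 \in A & p.1 + p.2 \in A]].
have -> : rvalue (A :|: [set b1; b2]) =
    #|R :|: (if s \in A then klein_pairs b1 b2 else set0)|.
  apply: eq_card => -[x y]; rewrite inE /= sum_closed_add_pair.
  by rewrite [RHS]inE [_ \in R]inE /= -/s; case: ifP => _ //=; rewrite inE.
rewrite -/s; case: ifP => _; last by rewrite setU0 addn0.
have H0 : 0 \in H by rewrite -(addrr2 0) addH eqxx.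
rewrite cardsU card_klein_pairs //.
- suff -> : R :&: klein_pairs b1 b2 = set0 by rewrite cards0 subn0.
  (* Only one of the three elements b1, b2, b1 + b2 is in H, so two distinct
     ones cannot both be in A. *)
  apply/setP => -[x y]; rewrite !inE /=; apply/negP.
  case/andP=> /and3P[/A_H xH /A_H yH _] /and3P[xT yT /eqP]; apply.
  have inH u : u \in H -> (u == b1) || (u == b2) || (u == b1 + b2) -> u = s.
    move=> uH /orP[/orP[]|] /eqP // uE.
      by case/negP: b1H; rewrite -uE.
    by case/negP: b2H; rewrite -uE.
  by rewrite (inH x) // (inH y).
- by apply: contraNneq b1H => ->.
- by apply: contraNneq b2H => ->.
Qed.

End ElementaryTwoGroup.

Lemma F2vec_addrr n (v : F2vec n) : v + v = 0.
Proof.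
apply/rowP => i; rewrite !mxE -mulr2n -mulr_natr.
by rewrite (_ : 2%:R = 0) ?mulr0 //; apply/eqP.
Qed.

Lemma mem_subF2_add n (v w : F2vec n) : (0 < n)%N ->
  (v + w \in subF2 n) = ((v \in subF2 n) == (w \in subF2 n)).
Proof.
move=> n_gt0.
have memE (u : F2vec n) : (u \in subF2 n) = (u 0 (Ordinal n_gt0) == 0).
  rewrite inE; apply/forallP/idP => [/(_ (Ordinal n_gt0))//|u0 i].
  by apply/implyP => /eqP i0; rewrite (_ : i = Ordinal n_gt0) //; apply: val_inj.
rewrite !memE mxE.
by case: (v 0 _) (w 0 _) => [[|[|//]] ?] [[|[|//]] ?].
Qed.

Theorem proposition4p3 (n k : nat) (hn : (2 <= n)%N) (hk : (2 <= k)%N)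
    (a : 'I_k -> F2vec n) (b1 b2 : F2vec n)
    (a_inj : injective a)
    (ha : forall i : 'I_k, a i \in subF2 n :\ 0)
    (hb1 : b1 \notin subF2 n) (hb2 : b2 \notin subF2 n) (hb : b1 <> b2) :
  rvalue ([set a i | i : 'I_k] :|: [set b1; b2]) =
  (rvalue [set a i | i : 'I_k] +
     (if (b1 + b2)%R \in [set a i | i : 'I_k] then 6 else 0))%N.
Proof.
apply: (@rvalue_add_pair _ _ (subF2 n)) => //.
- exact: F2vec_addrr.
- by move=> v w; apply: mem_subF2_add; apply: ltnW.
- by apply/subsetP => _ /imsetP[i _ ->].
- exact/eqP.
Qed.
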